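(* Let $W_0,W_1,W_2$ be complex numbers and let $(W_n)_{n\in\mathbb{Z}}$ be the unique two-sided sequence with these values at $0,1,2$ satisfying $W_n=2W_{n-2}+W_{n-3}$ for all integers $n$. Then for every integer $n\ge 1$: (a) $\displaystyle\sum_{k=1}^{n}W_{-k}=\frac{1}{2}\left(-3W_{-n-1}-3W_{-n-2}-W_{-n-3}+W_{2}+W_{1}-W_{0}\right).$ (b) $\displaystyle\sum_{k=1}^{n}W_{-2k}=-W_{-2n+1}+W_{-2n}+(W_{1}-W_{0})+(W_{2}-W_{1}-W_{0})n.$ (c) $\displaystyle\sum_{k=1}^{n}W_{-2k+1}=\frac{1}{2}\left(W_{-2n+1}-3W_{-2n}-W_{-2n-1}+(W_{2}-W_{1}+W_{0})+2(-W_{2}+W_{1}+W_{0})n\right).$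
   Context: This is the generalized Tribonacci sequence $W_n=rW_{n-1}+sW_{n-2}+tW_{n-3}$ with $r=0$, $s=2$, $t=1$ and arbitrary complex initial values, extended to negative subscripts so that the recurrence holds for all integers $n$. *)

(* Defs.v *)
From mathcomp Require Import all_boot all_order all_algebra ring zify.
From mathcomp Require Export complex.
From mathcomp Require Import reals.

Set Implicit Arguments.
Unset Strict Implicit.
Unset Printing Implicit Defensive.

Import GRing.Theory.
Local Open Scope ring_scope.

(* Generalized Tribonacci recurrence with (r, s, t) = (0, 2, 1). *)
Definition is_trib021 (R : realType) (W0 W1 W2 : R[i]) (W : int -> R[i]) : Prop :=
  [/\ W 0 = W0, W 1 = W1, W 2 = W2
    & forall n : int, W n = 2 * W (n - 2) + W (n - 3)].

(* [is_trib021 W0 W1 W2] characterizes exactly one two-sided sequence, so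
   quantifying over all W satisfying it is the same as fixing "the" sequence. *)
Section ExistsUnique.
Variables (R : realType) (W0 W1 W2 : R[i]).
Implicit Type (p : R[i] * R[i] * R[i]).

Let fwd p := (p.1.2, p.2, 2 * p.1.2 + p.1.1).
Let bwd p := (p.2 - 2 * p.1.1, p.1.1, p.1.2).
Let st (n : int) := match n with
  | Posz m => iter m fwd (W0, W1, W2)
  | Negz m => iter m.+1 bwd (W0, W1, W2) end.

Let stS (n : int) : st (n + 1) = fwd (st n).
Proof.
have fb p : fwd (bwd p) = p.
  by case: p => [[a b] c]; rewrite /fwd /bwd /=; congr (_, _, _); ring.
case: n => [m|[|m]]; first by rewrite -PoszD addn1.
  by rewrite /= fb.
by rewrite (_ : Negz m.+1 + 1 = Negz m) ?[RHS]fb //; lia.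
Qed.

Lemma is_trib021_exists : exists W, is_trib021 W0 W1 W2 W.
Proof.
exists (fun n => (st n).1.1); split=> // n.
have e1 : n - 2 = n - 3 + 1 by lia.
have e0 : n = n - 3 + 1 + 1 + 1 by lia.
by rewrite [in LHS]e0 e1 !stS /fwd /=.
Qed.

Lemma is_trib021_unique (W W' : int -> R[i]) :
  is_trib021 W0 W1 W2 W -> is_trib021 W0 W1 W2 W' -> W =1 W'.
Proof.
case=> a0 a1 a2 aS [b0 b1 b2 bS].
have pos m : [/\ W (Posz m) = W' (Posz m), W (Posz m.+1) = W' (Posz m.+1)
               & W (Posz m.+2) = W' (Posz m.+2)].
  elim: m => [|m [h0 h1 h2]]; first by split; rewrite ?a0 ?a1 ?a2 ?b0 ?b1 ?b2.
  split=> //; rewrite aS bS.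
  rewrite (_ : Posz m.+3 - 2 = Posz m.+1); last by lia.
  by rewrite (_ : Posz m.+3 - 3 = Posz m) ?h0 ?h1 //; lia.
have neg m : [/\ W (- Posz m) = W' (- Posz m), W (1 - Posz m) = W' (1 - Posz m)
               & W (2 - Posz m) = W' (2 - Posz m)].
  elim: m => [|m [h0 h1 h2]].
    by have [p0 p1 p2] := pos 0%N; rewrite subr0 subr0 oppr0.
  have e1 : 1 - Posz m.+1 = - Posz m by lia.
  have e2 : 2 - Posz m.+1 = 1 - Posz m by lia.
  have e3 : 2 - Posz m - 2 = - Posz m by lia.
  have e4 : 2 - Posz m - 3 = - Posz m.+1 by lia.
  split; rewrite ?e1 ?e2 //; move: h2.
  by rewrite aS bS e3 e4 h0 => /addrI.
by case=> m; [case: (pos m) | rewrite NegzE; case: (neg m.+1)].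
Qed.

End ExistsUnique.

(* Main.v *)
(* The characteristic polynomial x^3 - 2x - 1 factors as (x + 1)(x^2 - x - 1),
   so W_{m+1} - W_m - W_{m-1} only changes sign from one index to the next; its
   constant value on odd indices is W_2 - W_1 - W_0, the coefficient of the
   linear term in (b) and, up to sign, in (c). All three sums then telescope. *)
Require Import Defs.
From mathcomp Require Import all_boot all_order all_algebra complex reals.
From mathcomp Require Import ring zify.

Import GRing.Theory.
Local Open Scope ring_scope.

Section Trib021.
Variables (A : comPzRingType) (W : int -> A).
Hypothesis WE : forall n : int, W n = 2 * W (n - 2) + W (n - 3).

(** Passing the index relations as equations lets literals and offsets [x - c] be used alike, with
    [lia] settling the arithmetic. *)
Lemma trib021_shift (m a b : int) :
  a = m + 1 -> b = m + 3 -> W b = 2 * W a + W m.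
Proof. by move=> -> ->; rewrite WE; congr (2 * W _ + W _); lia. Qed.

(** Two sign changes cancel: expanding the two leading terms by the recurrence turns the defect at
    index [x] into the one at [x - 2]. *)
Lemma trib021_even_defect (n : nat) :
  W (- 2 * n%:Z) - W (- 2 * n%:Z - 1) - W (- 2 * n%:Z - 2) = W 2 - W 1 - W 0.
Proof.
elim: n => [|n IH].
  rewrite mulr0 !sub0r (@trib021_shift (-1) 0 2) // (@trib021_shift (-2) (-1) 1) //.
  by ring.
rewrite -IH (_ : - 2 * n.+1%:Z = - 2 * n%:Z - 2); last by lia.
set x := - 2 * n%:Z.
rewrite (@trib021_shift (x - 3) (x - 2) x); [|lia..].
rewrite (@trib021_shift (x - 4) (x - 3) (x - 1)); [|lia..].
rewrite (_ : x - 2 - 1 = x - 3); last by lia.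
rewrite (_ : x - 2 - 2 = x - 4); last by lia.
by ring.
Qed.

(** Raising [n] by one changes the right side by [3 W(x-1) - 2 W(x-3) - W(x-4)] with [x = -n], which
    the recurrence reduces to [2 W(x-1)]. The factor 2 stays on the left since [A] is only a
    ring. *)
Lemma sum_trib021_neg (n : nat) :
  2 * \sum_(1 <= k < n.+1) W (- k%:Z)
  = - 3 * W (- n%:Z - 1) - 3 * W (- n%:Z - 2) - W (- n%:Z - 3)
    + W 2 + W 1 - W 0.
Proof.
elim: n => [|n IH].
  rewrite big_nil oppr0 !sub0r (@trib021_shift (-1) 0 2) //.
  by rewrite (@trib021_shift (-2) (-1) 1) // (@trib021_shift (-3) (-2) 0) //; ring.
rewrite big_nat_recr //= mulrDr IH.
rewrite (_ : - n.+1%:Z = - n%:Z - 1); last by lia.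
set x := - n%:Z.
rewrite (@trib021_shift (x - 4) (x - 3) (x - 1)); [|lia..].
rewrite (_ : x - 1 - 1 = x - 2); last by lia.
rewrite (_ : x - 1 - 2 = x - 3); last by lia.
rewrite (_ : x - 1 - 3 = x - 4); last by lia.
by ring.
Qed.

Lemma sum_trib021_neg_even (n : nat) :
  \sum_(1 <= k < n.+1) W (- 2 * k%:Z)
  = - W (- 2 * n%:Z + 1) + W (- 2 * n%:Z)
    + (W 1 - W 0) + (W 2 - W 1 - W 0) * n%:R.
Proof.
elim: n => [|n IH]; first by rewrite big_nil mulr0 add0r; ring.
rewrite big_nat_recr //= IH -[n.+1%:R]natr1.
(* The slope of the linear term becomes the defect at [- 2 * n], so the increment involves only
   terms near that index. *)
rewrite -(trib021_even_defect n).
rewrite (_ : - 2 * n.+1%:Z = - 2 * n%:Z - 2); last by lia.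
set x := - 2 * n%:Z.
rewrite (@trib021_shift (x - 2) (x - 1) (x + 1)); [|lia..].
rewrite (_ : x - 2 + 1 = x - 1); last by lia.
by ring.
Qed.

Lemma sum_trib021_neg_odd (n : nat) :
  2 * \sum_(1 <= k < n.+1) W (- 2 * k%:Z + 1)
  = W (- 2 * n%:Z + 1) - 3 * W (- 2 * n%:Z) - W (- 2 * n%:Z - 1)
    + (W 2 - W 1 + W 0) + 2 * (- W 2 + W 1 + W 0) * n%:R.
Proof.
elim: n => [|n IH].
  by rewrite big_nil mulr0 sub0r add0r (@trib021_shift (-1) 0 2) //; ring.
rewrite big_nat_recr //= mulrDr IH -[n.+1%:R]natr1.
(* Here the slope is the defect with opposite sign. *)
have -> : - W 2 + W 1 + W 0 = - (W 2 - W 1 - W 0) by ring.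
rewrite -(trib021_even_defect n).
rewrite (_ : - 2 * n.+1%:Z = - 2 * n%:Z - 2); last by lia.
set x := - 2 * n%:Z.
rewrite (@trib021_shift (x - 2) (x - 1) (x + 1)); [|lia..].
rewrite (@trib021_shift (x - 3) (x - 2) x); [|lia..].
rewrite (_ : x - 2 + 1 = x - 1); last by lia.
rewrite (_ : x - 2 - 1 = x - 3); last by lia.
by ring.
Qed.

End Trib021.

Theorem theorem3p13 (R : realType) (W0 W1 W2 : R[i]) (W : int -> R[i])
  (hW : is_trib021 W0 W1 W2 W) (n : nat) (hn : (1 <= n)%N) :
  [/\ \sum_(1 <= k < n.+1) W (- k%:Z)
        = (- 3 * W (- n%:Z - 1) - 3 * W (- n%:Z - 2) - W (- n%:Z - 3)
           + W2 + W1 - W0) / 2,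
      \sum_(1 <= k < n.+1) W (- 2 * k%:Z)
        = - W (- 2 * n%:Z + 1) + W (- 2 * n%:Z)
          + (W1 - W0) + (W2 - W1 - W0) * n%:R
    & \sum_(1 <= k < n.+1) W (- 2 * k%:Z + 1)
        = (W (- 2 * n%:Z + 1) - 3 * W (- 2 * n%:Z) - W (- 2 * n%:Z - 1)
           + (W2 - W1 + W0) + 2 * (- W2 + W1 + W0) * n%:R) / 2].
Proof.
case: hW => <- <- <- WE.
(* Division by 2 is legitimate because [R[i]] has characteristic zero. *)
have half (x y : R[i]) : 2 * x = y -> x = y / 2.
  by move=> <-; rewrite mulrC mulKf // Num.Theory.pnatr_eq0.
split; last 1 first.
- exact/half/sum_trib021_neg_odd.
- exact/half/sum_trib021_neg.
- exact: sum_trib021_neg_even.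
Qed.
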